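(* Let $G$ be a graph of order $n$. Then $\lambda(G)=0$ if and only if $G=K_n$ or $G=\overline{K_n}$.
   Context: Graphs are finite, simple (no loops or multiple edges), undirected; $n=|V(G)|$ is the order of $G$ (at least 1). $K_n$ is the complete graph and $\overline{K_n}$ the edgeless graph on $n$ vertices. Standard zero forcing: a subset $S\subseteq V(G)$ is colored blue and all other vertices white. Standard color change rule: if a blue vertex has exactly one white neighbor, then that white neighbor becomes blue. $S$ is a zero forcing set if repeated application of the rule eventually turns all vertices blue. The zero forcing span $\lambda(G)$ is the number of distinct cardinalities $k$ for which there exist $Z,F\subseteq V(G)$ with $|Z|=|F|=k$ such that $Z$ is a zero forcing set and $F$ is not a zero forcing set. *)

(* Defs.v *)
From mathcomp Require Import all_boot.

Set Implicit Arguments.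
Unset Strict Implicit.
Unset Printing Implicit Defensive.

Record sgraph := SGraph {
  vertex :> finType;
  adj : rel vertex;
  adj_sym : symmetric adj;
  adj_irrefl : irreflexive adj }.

Definition order_of (G : sgraph) : nat := #|G|.

Definition isomorphic (G H : sgraph) : Prop :=
  exists2 f : G -> H, bijective f & forall u v : G, adj (f u) (f v) = adj u v.

Definition complete_rel (n : nat) : rel 'I_n := fun i j => i != j.

Lemma complete_rel_sym n : symmetric (@complete_rel n).
Proof. by move=> i j; rewrite /complete_rel eq_sym. Qed.

Lemma complete_rel_irrefl n : irreflexive (@complete_rel n).
Proof. by move=> i; rewrite /complete_rel eqxx. Qed.

Definition complete_graph (n : nat) : sgraph :=
  SGraph (@complete_rel_sym n) (@complete_rel_irrefl n).

Definition edgeless_rel (n : nat) : rel 'I_n := fun _ _ => false.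

Lemma edgeless_rel_sym n : symmetric (@edgeless_rel n).
Proof. by []. Qed.

Lemma edgeless_rel_irrefl n : irreflexive (@edgeless_rel n).
Proof. by []. Qed.

Definition edgeless_graph (n : nat) : sgraph :=
  SGraph (@edgeless_rel_sym n) (@edgeless_rel_irrefl n).

Section ZeroForcing.
Variable G : sgraph.
Implicit Types B S : {set G}.

Definition white_neighbors B (u : G) : {set G} :=
  [set v | adj u v & v \notin B].

(* One application of the color change rule: the set B of blue vertices
   becomes B' because some blue u has w as its only white neighbor. *)
Definition color_change : rel {set G} := fun B B' =>
  [exists u in B, exists w, (white_neighbors B u == [set w]) && (B' == w |: B)].

Definition zero_forcing_set S : bool := connect color_change S [set: G].

(* A subset of the vertices has at most #|G| elements, so that 'I_#|G|.+1
   contains all the candidate cardinalities. *)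
Definition zero_forcing_span : nat :=
  #|[set k : 'I_#|G|.+1 | [exists Z : {set G}, exists F : {set G},
      [&& #|Z| == k, #|F| == k, zero_forcing_set Z & ~~ zero_forcing_set F]]]|.

End ZeroForcing.

(* Main.v *)
Require Import Defs.
From mathcomp Require Import all_boot.

(** For the hard direction, suppose forcing depends only on cardinality, that
    [G] has an edge, and let [k] be the least size of a forcing set, so that all
    [k]-sets are forcing. By the edge some [(n-1)]-set is forcing, so all are:
    [k <= n - 1] and no vertex is isolated. A vertex of degree [< k]
    would let a set of size [k - 1] force a [k]-set, so the minimum degree is
    at least [k]. If [k = n - 1], then [G] is complete. Otherwise the first
    force in a [k]-set is made by a vertex [u] of degree exactly [k]; the first
    force out of the [k]-set [N(u)] must colour [u], and is made by some [w]
    with [N[w] = N[u]]. A vertex outside [{u, w}] is adjacent to both or neither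
    of [u] and [w], so it colours neither while both are white; hence a [k]-set
    avoiding both is not forcing. *)

Set Implicit Arguments.
Unset Strict Implicit.
Unset Printing Implicit Defensive.

Lemma ex_subset_between (T : finType) (A B : {set T}) m :
  A \subset B -> #|A| <= m <= #|B| ->
  exists S : {set T}, [/\ A \subset S, S \subset B & #|S| = m].
Proof.
move=> sAB; elim: m => [|m IHm] /andP[leAm lemB].
  by exists A; split=> //; apply/eqP; rewrite -leqn0.
case: ltngtP leAm => // [ltAm _|eqAm _]; last by exists A.
have [|S [sAS sSB cardS]] := IHm; first by rewrite -ltnS ltAm ltnW.
have /properP[_ [x xB xNS]] : S \proper B by rewrite properEcard sSB cardS.
exists (x |: S); split; last by rewrite cardsU1 xNS cardS.
  exact: subset_trans sAS (subsetU1 _ _).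
by rewrite subUset sub1set xB.
Qed.

Section ZeroForcing.
Variable G : sgraph.
Implicit Types (B S Z F : {set G}) (u v w : G).

Definition neighbors u : {set G} := [set v | adj u v].

Definition forcing_by_card :=
  forall Z F, #|Z| = #|F| -> zero_forcing_set Z -> zero_forcing_set F.

Lemma zero_forcing_span_eq0 : zero_forcing_span G = 0 <-> forcing_by_card.
Proof.
split=> [/eqP|forcing_card].
  rewrite cards_eq0 => /eqP span0 Z F eqZF Zforcing; apply: contraT => FNforcing.
  (* The common size of [Z] and [F], as an ordinal, would be counted by the span. *)
  have cardZ : #|Z| < #|G|.+1 by rewrite ltnS max_card.
  have := in_set0 (Ordinal cardZ); rewrite -span0 inE => /existsP[].
  exists Z; apply/existsP; exists F.
  by rewrite Zforcing FNforcing /= -eqZF eqxx.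
apply/eqP; rewrite cards_eq0; apply/eqP/setP=> k; rewrite !inE.
apply/existsP=> -[Z /existsP[F /and4P[/eqP cardZ /eqP cardF Zforcing]]].
by rewrite (forcing_card Z F) // cardZ cardF.
Qed.

Lemma color_changeP B B' :
  reflect (exists u w, [/\ u \in B, white_neighbors B u = [set w]
                         & B' = w |: B])
          (color_change B B').
Proof.
apply: (iffP existsP) => [[u /andP[uB /existsP[w /andP[/eqP ? /eqP ?]]]]|].
  by exists u, w.
case=> u [w [uB eqw ->]]; exists u.
by rewrite uB; apply/existsP; exists w; rewrite eqw !eqxx.
Qed.

Lemma zero_forcing_setT : zero_forcing_set [set: G].
Proof. exact: connect0. Qed.

Lemma zero_forcing_first_force S :
  zero_forcing_set S -> S != setT ->
  exists u w, [/\ u \in S, white_neighbors S u = [set w]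
                & zero_forcing_set (w |: S)].
Proof.
case/connectP=> [[|B p] /=]; first by move=> _ ->; rewrite eqxx.
case/andP=> /color_changeP[u [w [uS eqw ->]]] pathp lastp _.
by exists u, w; split=> //; apply/connectP; exists p.
Qed.

Lemma zero_forcing_step S u w :
  u \in S -> white_neighbors S u = [set w] -> zero_forcing_set (w |: S) ->
  zero_forcing_set S.
Proof.
move=> uS eqw; apply: connect_trans; apply/connect1/color_changeP.
by exists u, w.
Qed.

(** Every vertex but [v] is blue, so the blue vertex [u] has [v] as its only white neighbor and one
    force finishes. *)
Lemma zero_forcing_setC1 u v : adj u v -> zero_forcing_set (~: [set v]).
Proof.
move=> uv; apply: (@zero_forcing_step _ u v).
- by rewrite !inE; apply: contraTneq uv => ->; rewrite adj_irrefl.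
- apply/setP=> x; rewrite !inE negbK.
  by case: eqP => [->|]; rewrite ?andbF ?uv.
- by rewrite setUCr; exact: zero_forcing_setT.
Qed.

Lemma twins_stay_white S u w :
  u != w -> u |: neighbors u = w |: neighbors w ->
  u \notin S -> w \notin S -> ~~ zero_forcing_set S.
Proof.
move=> neq_uw /setP twins uNS wNS; apply/negP=> /connectP[p].
have eq_adj v : v != u -> v != w -> adj v u = adj v w.
  move=> vNu vNw; have := twins v.
  by rewrite !inE (negPf vNu) (negPf vNw) /= ![adj v _]adj_sym.
elim: p S uNS wNS => [|B p IHp] S uNS wNS /=.
  by move=> _ eqS; rewrite -eqS inE in uNS.
case/andP=> /color_changeP[v [x [vS /setP eqx ->]]]; apply: IHp; rewrite !inE.
(* If [v] forced one twin, it would also be adjacent to the other, which is still white, so its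
   white neighborhood would not be a singleton. *)
all: have [vNu vNw] : v != u /\ v != w by split; apply: contraTneq vS => ->.
all: have eq_ux := eqx u; have eq_wx := eqx w.
all: rewrite !inE uNS wNS !andbT in eq_ux eq_wx.
all: rewrite ?(negPf uNS) ?(negPf wNS) orbF; apply: contra neq_uw => /eqP eqx'.
  by rewrite eq_sym [X in _ == X]eqx' -eq_wx -eq_adj // eq_ux eqx' eqxx.
by rewrite [X in _ == X]eqx' -eq_ux eq_adj // eq_wx eqx' eqxx.
Qed.

(** A blue vertex sees the whole complement of the blue set, so a force is possible exactly when one
    white vertex and some blue vertex remain. This depends only on the size of the set. *)
Lemma complete_forcing_by_card :
  (forall u v, adj u v = (u != v)) -> forcing_by_card.
Proof.
move=> adjE Z F eqZF Zforcing.
have [->|FNT] := eqVneq F setT; first exact: zero_forcing_setT.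
have whiteE S u : u \in S -> white_neighbors S u = ~: S.
  move=> uS; apply/setP=> v; rewrite !inE adjE andb_idl // => vNS.
  by apply: contraNneq vNS => <-.
have ZNT : Z != setT.
  by apply: contraNneq FNT => ZT; rewrite eqEcard subsetT -eqZF ZT leqnn.
have [u [w [uZ + _]]] := zero_forcing_first_force Zforcing ZNT.
rewrite whiteE // => eqCZ.
have /cards1P[x eqCF] : #|~: F| == 1.
  have := cardsC F; rewrite -(cardsC Z) eqCZ cards1 eqZF => /addnI ->.
  by [].
(* A force needs a blue vertex: [F] has one because [Z], of the same size, contains [u]. *)
have /card_gt0P[v vF] : 0 < #|F| by rewrite -eqZF; apply/card_gt0P; exists u.
apply: (zero_forcing_step vF (w := x)); first by rewrite whiteE.
by rewrite -eqCF setUC setUCr; exact: zero_forcing_setT.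
Qed.

(** No force is ever possible, so only the full vertex set is forcing. *)
Lemma edgeless_forcing_by_card :
  (forall u v, adj u v = false) -> forcing_by_card.
Proof.
move=> adjE Z F eqZF Zforcing.
have [ZT|ZNT] := eqVneq Z setT.
  have -> : F = setT by apply/eqP; rewrite eqEcard subsetT -eqZF ZT leqnn.
  exact: zero_forcing_setT.
have [u [w [_ /setP/(_ w) + _]]] := zero_forcing_first_force Zforcing ZNT.
by rewrite !inE adjE eqxx.
Qed.

Lemma card_closed_neighbors u : #|u |: neighbors u| = #|neighbors u|.+1.
Proof. by rewrite cardsU1 inE adj_irrefl. Qed.

Lemma white_neighbors1_sub S u w :
  white_neighbors S u = [set w] -> neighbors u \subset w |: S.
Proof.
move=> /setP eqw; apply/subsetP=> v; rewrite !inE => uv.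
by have := eqw v; rewrite !inE uv /= => <-; case: (v \in S).
Qed.

Section MinimumForcing.
Variable k : nat.
Hypothesis k_forcing : forall S, #|S| = k -> zero_forcing_set S.
Hypothesis k_min : forall S, #|S| < k -> ~~ zero_forcing_set S.

Lemma min_forcing_le_degree u v :
  adj u v -> k <= #|neighbors u|.
Proof.
move=> uv; rewrite leqNgt; apply/negP=> ltdk.
have kn : k <= #|G|.
  rewrite leqNgt; apply/negP; rewrite -cardsT => /k_min.
  by rewrite zero_forcing_setT.
(* Any set containing [A] and missing [v] lets [u] force [v]. As [A] has as many elements as [u] has
   neighbors, fewer than [k], it extends to such a set [S] of size [k - 1], which then forces a
   [k]-set against minimality. *)
pose A := (u |: neighbors u) :\ v.
have cardA : #|A| = #|neighbors u|.
  have := cardsD1 v (u |: neighbors u).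
  by rewrite card_closed_neighbors !inE uv orbT => -[].
have [|| S [sAS sSv cardS]] := @ex_subset_between _ A (~: [set v]) k.-1.
- by apply/subsetP=> x; rewrite !inE => /andP[].
- rewrite cardA cardsC1 -!subn1 leq_sub2r // andbT subn1.
  by rewrite -ltnS (ltn_predK ltdk).
have vNS : v \notin S by apply/negP=> /(subsetP sSv); rewrite !inE eqxx.
have k_gt0 : 0 < k by apply: leq_ltn_trans ltdk.
have /negP[] : ~~ zero_forcing_set S by apply: k_min; rewrite cardS prednK.
have uNv : u != v by apply: contraTneq uv => ->; rewrite adj_irrefl.
apply: (@zero_forcing_step _ u v).
- by apply: (subsetP sAS); rewrite !inE uNv eqxx.
- apply/setP=> x; rewrite !inE; have [->|xNv] := eqVneq x v; first by rewrite uv.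
  apply/negP=> /andP[ux /negP[]]; apply: (subsetP sAS).
  by rewrite !inE xNv ux orbT.
- by apply: k_forcing; rewrite cardsU1 vNS cardS add1n prednK.
Qed.

Hypothesis no_isolated : forall v, exists u, adj v u.

Lemma min_forcing_ge_pred_order : #|G|.-1 <= k.
Proof.
rewrite leqNgt; apply/negP=> ltkn.
have kn : k < #|G| by apply: leq_trans ltkn (leq_pred _).
have deg v : k <= #|neighbors v|.
  by have [u vu] := no_isolated v; apply: min_forcing_le_degree vu.
have first_force S : #|S| = k ->
    exists u w, u \in S /\ white_neighbors S u = [set w].
  move=> cardS; have SNT : S != setT.
    by apply: contraTneq kn => ST; rewrite -cardS ST cardsT ltnn.
  have [u [w [? ? _]]] := zero_forcing_first_force (k_forcing cardS) SNT.
  by exists u, w.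
have [||S [_ _ cardS]] := @ex_subset_between G set0 setT k.
- exact: sub0set.
- by rewrite cards0 cardsT leq0n ltnW.
have [u [x [uS eqx]]] := first_force _ cardS.
(* Since [u] forces [x], its closed neighborhood lies in [x |: S], which has at most [k + 1]
   elements. *)
have degu : #|neighbors u| = k.
  apply/eqP; rewrite eqn_leq deg andbT -ltnS -card_closed_neighbors.
  apply: (@leq_trans #|x |: S|).
    by rewrite subset_leq_card // subUset (white_neighbors1_sub eqx) sub1set
               inE uS orbT.
  by rewrite cardsU1 cardS; case: (_ \notin _).
have [w [y [wu eqy]]] := first_force _ degu.
have uw : adj u w by rewrite inE in wu.
(* [u] is a neighbor of [w] and is white, not being its own neighbor. *)
have eqyu : y = u.
  have /setP/(_ u) := eqy; rewrite !inE adj_sym uw adj_irrefl /=.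
  by move=> /esym/eqP.
(* Inclusion from left to right comes from the force by [w]; equality follows because [w] has degree
   at least [k], the degree of [u]. *)
have twins : w |: neighbors w = u |: neighbors u.
  apply/eqP; rewrite eqEcard !card_closed_neighbors degu ltnS deg andbT.
  have := white_neighbors1_sub eqy; rewrite eqyu subUset => ->.
  by rewrite sub1set !inE uw orbT.
have wNu : w != u by apply: contraTneq uw => ->; rewrite adj_irrefl.
(* Here [k <= n - 2] leaves room for a [k]-set avoiding both twins. *)
have [||R [_ sR cardR]] := @ex_subset_between G set0 (~: [set w; u]) k.
- exact: sub0set.
- have := cardsC [set w; u]; rewrite cards2 wNu cards0 /= => eqn.
  by move: ltkn; rewrite -eqn add2n ltnS.
have := k_forcing cardR; apply/negP/(twins_stay_white wNu twins).
- by apply/negP=> /(subsetP sR); rewrite !inE eqxx.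
- by apply/negP=> /(subsetP sR); rewrite !inE eqxx orbT.
Qed.

End MinimumForcing.

Lemma forcing_by_card_complete u0 v0 :
  adj u0 v0 -> forcing_by_card -> forall u v, adj u v = (u != v).
Proof.
move=> uv0 forcing_card.
(* The complement of [v] is as large as that of [v0], hence forcing. Its first force can only colour
   [v], so it comes from a neighbor of [v]. *)
have no_isolated v : exists u, adj v u.
  have cardC1 : #|~: [set v0]| = #|~: [set v]| by rewrite !cardsC1.
  have := forcing_card _ _ cardC1 (zero_forcing_setC1 uv0).
  case/zero_forcing_first_force.
    by apply/eqP=> /setP/(_ v); rewrite !inE eqxx.
  move=> u [w [_ /setP/(_ w) + _]]; rewrite !inE eqxx negbK => /andP[uw /eqP eqw].
  by exists u; rewrite adj_sym -eqw.
pose P := zero_forcing_set (G := G).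
have [Z Zforcing Zmin] := arg_minnP (P := P) (fun S => #|S|) zero_forcing_setT.
have deg v : #|G|.-1 <= #|neighbors v|.
  have k_forcing S : #|S| = #|Z| -> zero_forcing_set S.
    by move=> eqS; apply: forcing_card Zforcing.
  have k_min S : #|S| < #|Z| -> ~~ zero_forcing_set S.
    by rewrite ltnNge; apply: contra => /Zmin.
  have [u vu] := no_isolated v.
  apply: leq_trans (min_forcing_le_degree k_forcing k_min vu).
  exact: min_forcing_ge_pred_order.
move=> u v; have [->|uNv] := eqVneq u v; first exact: adj_irrefl.
(* The neighborhood of [u] omits [u] and has at least [n - 1] elements. *)
have /eqP/setP/(_ v) : neighbors u == ~: [set u].
  rewrite eqEcard cardsC1 deg andbT; apply/subsetP=> x; rewrite !inE.
  by apply: contraTneq => ->; rewrite adj_irrefl.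
by rewrite !inE eq_sym uNv.
Qed.

Lemma isomorphic_complete :
  isomorphic G (complete_graph #|G|) <-> forall u v, adj u v = (u != v).
Proof.
split=> [[f f_bij adjf] u v|adjE].
  by rewrite -adjf /= /complete_rel (bij_eq f_bij).
exists (@enum_rank G); first exact: enum_rank_bij.
by move=> u v; rewrite adjE /= /complete_rel (bij_eq (@enum_rank_bij G)).
Qed.

Lemma isomorphic_edgeless :
  isomorphic G (edgeless_graph #|G|) <-> forall u v, adj u v = false.
Proof.
split=> [[f _ adjf] u v|adjE]; first by rewrite -adjf.
by exists (@enum_rank G); [exact: enum_rank_bij | move=> u v; rewrite adjE].
Qed.

End ZeroForcing.

Theorem theorem6 (n : nat) (G : sgraph) (hn : 0 < n) (hG : order_of G = n) :
  zero_forcing_span G = 0 <->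
  isomorphic G (complete_graph n) \/ isomorphic G (edgeless_graph n).
Proof.
rewrite -{}hG /order_of; split=> [/zero_forcing_span_eq0 forcing_card|].
  have [/existsP[u /existsP[v uv]]|noedge] :=
    boolP [exists u : G, exists v : G, adj u v].
    left; apply/isomorphic_complete.
    exact: forcing_by_card_complete uv forcing_card.
  right; apply/isomorphic_edgeless=> u v.
  apply/negbTE; apply: contra noedge => uv.
  by apply/existsP; exists u; apply/existsP; exists v.
move=> G_iso; apply/zero_forcing_span_eq0; case: G_iso.
  by move=> /isomorphic_complete; apply: complete_forcing_by_card.
by move=> /isomorphic_edgeless; apply: edgeless_forcing_by_card.
Qed.
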